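(* Let $f\in\Gamma_0(X)$ with $Y\cap\operatorname{dom} f^*\neq\varnothing$. Then there exists a unique pair of vectors $(e,d)\in Y\times Y$ such that $d=Se\in\operatorname{dom} f^*$, $e=Qd$, and $$(\forall y\in Y)\quad f^*(Se)+\langle y-Se,e\rangle-f^*(y)\leq 0;$$ equivalently (the displayed condition can be restated as), $e\in\partial(f^*+\iota_Y)(Se)$. Consequently, $$(\forall x\in X)\quad f^*(Se)+\langle Sx-Se,e\rangle-f^*(Sx)\leq 0.$$
   Context: $X$ is a real Hilbert space with inner product $\langle\cdot,\cdot\rangle$ and induced norm $\|\cdot\|$. $m\in\{1,2,\dots\}$ and $R:X\to X$ is a linear isometry ($\|Rx\|=\|x\|$ for all $x$) with $R^m=\mathrm{Id}$. $\operatorname{Fix}R=\{x\in X: Rx=x\}$ and $Y=(\operatorname{Fix}R)^\perp$ (which coincides with $\ker\big(\frac1m\sum_{i=1}^m R^i\big)$). $S=R-\mathrm{Id}$ and $Q=\frac1m\sum_{i=1}^{m-1} iR^i$. $\Gamma_0(X)$ is the set of proper lower semicontinuous convex functions $X\to\,]-\infty,+\infty]$. For $f:X\to\,]-\infty,+\infty]$, $f^*(x^* )=\sup_{x\in X}(\langle x,x^*\rangle-f(x))$ is the Fenchel conjugate, $\operatorname{dom} f=\{x: f(x)<+\infty\}$, and $\partial f(x)=\{x^*\in X: f(y)\ge f(x)+\langle x^*,y-x\rangle\ \forall y\in X\}$. $\iota_C$ is the indicator function of $C$ ($0$ on $C$, $+\infty$ off $C$). *)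

(* Defs.v *)
From HB Require Import structures.
From mathcomp Require Import all_boot all_order all_algebra sesquilinear.
From mathcomp Require Import all_classical all_reals all_analysis.

Set Implicit Arguments.
Unset Strict Implicit.
Unset Printing Implicit Defensive.

Import Order.TTheory GRing.Theory Num.Theory.
Import numFieldNormedType.Exports.

Local Open Scope classical_set_scope.
Local Open Scope ring_scope.

(* Functions X -> ]-oo, +oo] are functions into \bar K; that -oo is never taken
   is part of [Gamma0]. *)
Section ConvexAnalysis.
Context {K : realType} {X : completeNormedModType K}.
Local Open Scope ereal_scope.

Definition effective_domain (f : X -> \bar K) : set X := [set x | f x < +oo].

Definition proper_function (f : X -> \bar K) : Prop :=
  (forall x, -oo < f x) /\ effective_domain f !=set0.

(* The library's [convex_function] is for real-valued functions only. For
   t = 0, 1 the inequality is trivial, so the open range of t loses nothing. *)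
Definition convex_efunction (f : X -> \bar K) : Prop :=
  forall (x y : X) (t : K), (0 < t < 1)%R ->
    f (t *: x + (1 - t) *: y)%R <= t%:E * f x + (1 - t)%:E * f y.

Definition Gamma0 (f : X -> \bar K) : Prop :=
  [/\ proper_function f, lower_semicontinuous f & convex_efunction f].

Definition indicator (C : set X) (x : X) : \bar K :=
  if x \in C then 0 else +oo.

Definition conjugate (dot : X -> X -> K) (f : X -> \bar K) (u : X) : \bar K :=
  ereal_sup [set (dot x u)%:E - f x | x in [set: X]].

Definition subdifferential (dot : X -> X -> K) (f : X -> \bar K) (x : X)
    : set X :=
  [set u | forall y, f x + (dot u (y - x)%R)%:E <= f y].

End ConvexAnalysis.

Section CyclicIsometry.
Context {K : realType} {X : completeNormedModType K}.

Definition Fix (R : X -> X) : set X := [set x | R x = x].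

Definition orthocomplement (dot : X -> X -> K) (A : set X) : set X :=
  [set x | forall a, A a -> dot x a = 0].

Definition Yspace (dot : X -> X -> K) (R : X -> X) : set X :=
  orthocomplement dot (Fix R).

Definition Sop (R : X -> X) (x : X) : X := R x - x.

Definition Qop (m : nat) (R : X -> X) (x : X) : X :=
  m%:R^-1 *: \sum_(1 <= i < m) i%:R *: iter i R x.

End CyclicIsometry.

(* Main.v *)
Require Import Defs.
From HB Require Import structures.
From mathcomp Require Import all_boot all_order all_algebra sesquilinear.
From mathcomp Require Import all_classical all_reals all_analysis.
From mathcomp Require Import ring lra.
Import Order.TTheory GRing.Theory Num.Theory.
Import numFieldNormedType.Exports.
Local Open Scope classical_set_scope.
Local Open Scope ring_scope.

(** On [Y] the operator [Q] inverts [S], because telescoping gives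
    [S Q = Id - (1/m) sum_(i < m) R^i] and the average of an orbit is
    both fixed by [R] and, when the orbit starts in [Y], orthogonal to [Fix R].  With [d = S e] the problem therefore reads: find [d] in [Y] with
    [Q d] in [dg(d)], where [g = f^* + iota_Y], that is [0] in
    [dg(d) + B d] for [B = - Q].

    Since [R] is an isometry, [<S e, e> = - |S e|^2 / 2]; hence
    [<B d, d> = |d|^2 / 2] on [Y], so that [B] is strongly monotone there, and it
    is obviously Lipschitz.  Uniqueness follows at once: [dg] is monotone, so two
    solutions satisfy [0 <= - |d - d'|^2 / 2].

    Existence ([strongly_monotone_inclusion]) avoids the sum theorem for maximal
    monotone operators.  The inclusion says that [d] is a fixed point of
    [x |-> prox_(rho g) (x - rho B x)]; the proximal map is nonexpansive and the
    forward step [Id - rho B] contracts [Y] for a suitable [rho], so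
    Banach's theorem applies.  The proximal point itself ([proximal_point]) is
    the limit of a minimizing sequence of [g + |. - z|^2 / (2 rho)], a Cauchy
    sequence by strong convexity.  The affine minorant of [g] which bounds this
    function from below comes from a point of [dom f], and the
    membership of [g] in [Gamma0] from [f^*] being a supremum of continuous
    affine functions.

    The equivalence with [e] in [dg (S e)] holds because [f^*] is never [-oo] and
    [g = +oo] off [Y], and the last inequality because [S] maps [X] into [Y]. *)

(** * Inner products *)

Section InnerProduct.
Set Implicit Arguments.
Unset Strict Implicit.
Context (K : realType) (X : completeNormedModType K) (dot : {dot X for idfun}).

Lemma dotC u v : dot u v = dot v u.
Proof. by rewrite (hermC dot u v) expr0 mul1r. Qed.

Lemma dotDl u v w : dot (u + v) w = dot u w + dot v w.
Proof. exact: (linearDl dot). Qed.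

Lemma dotZl a u w : dot (a *: u) w = a * dot u w.
Proof. exact: (linearZl_LR dot). Qed.

Lemma dotNl u w : dot (- u) w = - dot u w.
Proof. by rewrite -scaleN1r dotZl mulN1r. Qed.

Lemma dotDr w u v : dot w (u + v) = dot w u + dot w v.
Proof. by rewrite dotC dotDl !(dotC _ w). Qed.

Lemma dotZr a w u : dot w (a *: u) = a * dot w u.
Proof. by rewrite dotC dotZl dotC. Qed.

Lemma dotNr w u : dot w (- u) = - dot w u.
Proof. by rewrite dotC dotNl dotC. Qed.

Lemma dot0l w : dot 0 w = 0.
Proof. by rewrite -(scale0r w) dotZl mul0r. Qed.

Definition dotE := (dotDl, dotDr, dotNl, dotNr, dotZl, dotZr).

Context (norm_dot : forall x : X, `|x| = Num.sqrt (dot x x)).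

Lemma sqr_norm x : `|x| ^+ 2 = dot x x.
Proof.
have [->|x0] := eqVneq x 0; first by rewrite normr0 expr0n dot0l.
by rewrite norm_dot sqr_sqrtr// ltW// neq0_dnorm_gt0.
Qed.

Lemma dot_ge0 x : 0 <= dot x x.
Proof. by rewrite -sqr_norm sqr_ge0. Qed.

Lemma dot_eq0 x : dot x x = 0 -> x = 0.
Proof. by rewrite -sqr_norm => /eqP; rewrite sqrf_eq0 normr_eq0 => /eqP. Qed.

(** Polarization expresses the form through the norm, whose continuity is known. *)
Lemma dot_continuous a : continuous (dot a).
Proof.
move=> y.
have -> : (dot a : X -> K) =
    fun x => 2^-1 * (`|a + x| ^+ 2 - `|a| ^+ 2 - `|x| ^+ 2).
  by apply/funext => x; rewrite !sqr_norm !dotE (dotC x a); field.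
have c1 : `|a + x| @[x --> y] --> `|a + y|.
  by apply: cvg_norm; apply: cvgD; [exact: cvg_cst|exact: cvg_id].
have c2 : `|x| @[x --> y] --> `|y| by apply: cvg_norm; exact: cvg_id.
apply: cvgM; first exact: cvg_cst.
apply: cvgB; first (apply: cvgB; last exact: cvg_cst).
  exact: (cvgM c1 c1).
exact: (cvgM c2 c2).
Qed.

(** Strong convexity of the squared distance to [z], with its exact defect term:
    the source of both the Cauchy estimate and the growth at the minimizer in
    [proximal_point]. *)
Lemma sqr_norm_combine (x y z : X) (t : K) :
  `|t *: x + (1 - t) *: y - z| ^+ 2 =
  t * `|x - z| ^+ 2 + (1 - t) * `|y - z| ^+ 2 - t * (1 - t) * `|x - y| ^+ 2.
Proof.
rewrite !sqr_norm !dotE (dotC y x) (dotC z x) (dotC z y); ring.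
Qed.

(** * Proximal points and monotone inclusions *)

Lemma lsc_limit_le (g : X -> \bar K) (u : X ^nat) (c : K ^nat) p l :
  lower_semicontinuous g -> u @ \oo --> p -> c @ \oo --> l ->
  (forall n, (g (u n) <= (c n)%:E)%E) -> (g p <= l%:E)%E.
Proof.
move=> glsc up cl guc; rewrite leNgt; apply/negP => lg.
have [r lr rg] : exists2 r : K, l < r & (r%:E < g p)%E.
  case: (g p) lg => [s| |]//; rewrite ?lte_fin => ls.
    by exists ((l + s) / 2); rewrite ?lte_fin midf_lt.
  by exists (l + 1); rewrite ?ltry// ltrDl.
have [V Vp Vr] := glsc _ _ rg.
have nV : \forall n \near \oo, V (u n) by exact: up.
have nc : \forall n \near \oo, c n < r by apply: (cvgr_lt _ cl).
near \oo => n.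
have /Vr : V (u n) by near: n.
rewrite ltNge (le_trans (guc n))// lee_fin ltW//.
by near: n.
Unshelve. all: by end_near. Qed.

Lemma Gamma0_fine {g : X -> \bar K} : Gamma0 g ->
  forall x, effective_domain g x -> g x = (fine (g x))%:E.
Proof.
move=> [[gNy _] _ _] x gx; rewrite fineK// fin_numE.
by rewrite gt_eqF ?gNy// lt_eqF.
Qed.

(** The point is the minimizer of [J y = g y + |y - z|^2 / (2 rho)].  The affine
    minorant bounds [J] below, and strong convexity makes minimizing sequences
    Cauchy.  It also forces [J] to grow by [|y - p|^2 / (2 rho)] away from the
    minimizer [p]; expanding the squares, the quadratic terms cancel and this
    growth becomes exactly the subgradient inequality. *)
Lemma proximal_point (g : X -> \bar K) (a : X) (b rho : K) (z : X) :
  0 < rho -> Gamma0 g -> (forall y, ((dot a y - b)%:E <= g y)%E) ->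
  exists2 p, effective_domain g p &
    subdifferential dot g p (rho^-1 *: (z - p)).
Proof.
move=> rho0 Gg minor; have gE := Gamma0_fine Gg.
case: (Gg) => [[gNy [x0 Dx0]] glsc gcvx].
pose k := (2 * rho)^-1; have k0 : 0 < k by rewrite invr_gt0 mulr_gt0.
pose J y := fine (g y) + k * `|y - z| ^+ 2.
(* [J] is strongly convex with modulus [2 k]. *)
have J_sc x y t : 0 < t < 1 -> effective_domain g x -> effective_domain g y ->
    let w := t *: x + (1 - t) *: y in effective_domain g w /\
    J w <= t * J x + (1 - t) * J y - t * (1 - t) * k * `|x - y| ^+ 2.
  move=> t01 Dx Dy w; have := gcvx x y t t01.
  rewrite -/w (gE _ Dx) (gE _ Dy) -!EFinM -EFinD => gw.
  have Dw : effective_domain g w by exact: (le_lt_trans gw (ltry _)).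
  split=> //; rewrite /J sqr_norm_combine.
  by move: gw; rewrite (gE _ Dw) lee_fin; lra.
pose E := [set J y | y in effective_domain g].
have hE : has_inf E.
  split; first by exists (J x0), x0.
  exists (dot a z - b - 2^-1 * rho * dot a a) => _ [y Dy <-].
  have := minor y; rewrite (gE _ Dy) lee_fin /J sqr_norm.
  have -> : dot a y = dot a z + dot a (y - z) by rewrite -dotDr addrC subrK.
  move: (y - z) => w.
  (* Completing the square: the bound is attained at [y = z - rho *: a]. *)
  have kr : k * rho = 2^-1 by rewrite /k; field; rewrite gt_eqF.
  have := mulr_ge0 (ltW k0) (dot_ge0 (rho *: a + w)).
  rewrite !dotE (dotC w a).
  have -> : k * (rho * (rho * dot a a) + rho * dot a w + (rho * dot a w + dot w w)) =
      k * rho * (rho * dot a a + 2 * dot a w) + k * dot w w by ring.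
  by rewrite kr; lra.
pose mu := inf E.
have mu_le y : effective_domain g y -> mu <= J y.
  by move=> Dy; apply: (ge_inf hE.2); exists y.
(* Strong convexity at the midpoint, whose value is at least [mu]. *)
have gap x y : effective_domain g x -> effective_domain g y ->
    k * `|x - y| ^+ 2 <= 2 * (J x - mu + (J y - mu)).
  move=> Dx Dy; have h01 : 0 < (2^-1 : K) < 1 by lra.
  have [Dw] := J_sc _ _ _ h01 Dx Dy; have := mu_le _ Dw; lra.
have /choice[u uP] : forall n : nat, exists y,
    effective_domain g y /\ J y <= mu + harmonic n.
  move=> n; have [_ [y Dy <-] Jy] := inf_adherent (harmonic_gt0 n) hE.
  by exists y; split=> //; exact: ltW.
have Du n : effective_domain g (u n) by case: (uP n).
have uJ n : J (u n) <= mu + harmonic n by case: (uP n).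
have /cvg_ex[/= p up] : cvgn u.
  apply/cauchy_cvgP/cauchyP => e e0.
  have ke0 : 0 < k * e ^+ 2 / 4 by rewrite divr_gt0// mulr_gt0// exprn_gt0.
  have [N _ hN] : \forall n \near \oo, harmonic n < k * e ^+ 2 / 4.
    by apply: (cvgr_lt _ cvg_harmonic).
  exists (u N); exists N => // n /= Nn; rewrite -ball_normE /=.
  have := gap _ _ (Du N) (Du n); have := uJ N; have := uJ n.
  have := hN N (leqnn N); have := hN n Nn => h1 h2 h3 h4 h5.
  rewrite -(ltr_pXn2r (n := 2)) ?nnegrE// ?ltW//.
  rewrite -(ltr_pM2l k0); lra.
have gp : (g p <= (mu + 0 - k * (`|p - z| * `|p - z|))%:E)%E.
  have cn : `|u n - z| @[n --> \oo] --> `|p - z|.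
    by apply: cvg_norm; apply: cvgB => //; exact: cvg_cst.
  apply: (@lsc_limit_le g u
    (fun n => mu + harmonic n - k * (`|u n - z| * `|u n - z|))) => //.
    apply: cvgB.
      by apply: cvgD; [exact: cvg_cst|exact: cvg_harmonic].
    by apply: cvgM; [exact: cvg_cst|exact: cvgM].
  by move=> n; rewrite (gE _ (Du n)) lee_fin; have := uJ n; rewrite /J expr2; lra.
have Dp : effective_domain g p by exact: (le_lt_trans gp (ltry _)).
have Jp : J p <= mu.
  by move: gp; rewrite (gE _ Dp) lee_fin /J expr2; lra.
exists p => // y.
have [->|/eqP gyoo] := eqVneq (g y) +oo%E; first by rewrite leey.
have Dy : effective_domain g y by rewrite /effective_domain /= ltey; exact/eqP.
have growth : J p + k * `|y - p| ^+ 2 <= J y.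
  rewrite leNgt; apply/negP => lt_growth.
  set s := k * `|y - p| ^+ 2 in lt_growth.
  have pos : 0 <= J y - J p by have := mu_le _ Dy; lra.
  have s0 : 0 < s by lra.
  (* For this [t] the point [t *: y + (1 - t) *: p] would lie strictly below the
     minimum: the gain [t (1 - t) s] exceeds the loss [t (J y - J p)]. *)
  pose t := (s - (J y - J p)) / (2 * s).
  have ts : t * s = (s - (J y - J p)) / 2 by rewrite /t; field; rewrite gt_eqF.
  have t0 : 0 < t by rewrite divr_gt0; lra.
  have t1 : t < 1 by rewrite ltr_pdivrMr; lra.
  have [Dw Jw] := J_sc y p t (introT andP (conj t0 t1)) Dy Dp.
  have := mu_le _ Dw; move: Jw.
  rewrite -mulrA -/s => Jw muw.
  have : 0 <= t * (J y - J p - (1 - t) * s) by lra.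
  by rewrite pmulr_rge0//; lra.
rewrite (gE _ Dp) (gE _ Dy) lee_fin dotZl.
have -> : rho^-1 = 2 * k by rewrite /k; field; rewrite gt_eqF.
have := growth; rewrite /J.
have -> : `|y - z| ^+ 2 = `|y - p| ^+ 2 - 2 * dot (z - p) (y - p) + `|p - z| ^+ 2.
  rewrite !sqr_norm !dotE (dotC z y) (dotC y p) (dotC z p); ring.
lra.
Qed.

Lemma subdifferential_monotone (g : X -> \bar K) x y u v :
  g x \is a fin_num -> g y \is a fin_num ->
  subdifferential dot g x u -> subdifferential dot g y v ->
  0 <= dot (u - v) (x - y).
Proof.
move=> /fineK gx /fineK gy /(_ y) + /(_ x).
rewrite -gx -gy !lee_fin -(opprB x y) dotNr (dotDl u) dotNl; lra.
Qed.

(** Forward-backward splitting.  A solution is a fixed point of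
    [x |-> P (x - rho *: B x)], [P] being the proximal map of [rho g], and this
    map sends [V] into itself, since [P] takes its values in the domain of [g],
    and contracts it. *)
Lemma strongly_monotone_inclusion (g : X -> \bar K) (a : X) (b : K)
    (V : set X) (B : X -> X) (alpha L : K) :
  Gamma0 g -> (forall y, ((dot a y - b)%:E <= g y)%E) ->
  closed V -> effective_domain g `<=` V -> 0 < alpha -> 0 < L ->
  (forall x y, V x -> V y ->
    alpha * `|x - y| ^+ 2 <= dot (B x - B y) (x - y)) ->
  (forall x y, V x -> V y -> `|B x - B y| <= L * `|x - y|) ->
  exists2 d, effective_domain g d & subdifferential dot g d (- B d).
Proof.
move=> Gg minor clV gV alpha0 L0 Bmono Blip.
(* This step minimizes [1 - 2 rho alpha + rho^2 L^2], which bounds the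
   squared Lipschitz constant of [Id - rho B] on [V]; the minimum is [c] below. *)
pose rho := alpha / L ^+ 2; have rho0 : 0 < rho by rewrite divr_gt0// exprn_gt0.
have /choice[P PP] : forall z, exists p, effective_domain g p /\
    subdifferential dot g p (rho^-1 *: (z - p)).
  by move=> z; have [p ? ?] := proximal_point z rho0 Gg minor; exists p.
have DP z : effective_domain g (P z) by case: (PP z).
have sP z : subdifferential dot g (P z) (rho^-1 *: (z - P z)) by case: (PP z).
have P_nonexp z z' : `|P z - P z'| ^+ 2 <= `|z - z'| ^+ 2.
  have fin w : g (P w) \is a fin_num by rewrite (Gamma0_fine Gg (DP w)).
  have := subdifferential_monotone (fin z) (fin z') (sP z) (sP z').
  rewrite -scalerBr dotZl pmulr_rge0 ?invr_gt0//.
  rewrite (_ : z - P z - (z' - P z') = (z - z') - (P z - P z')); last first.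
    by rewrite !opprD !opprK addrACA.
  (* From [0 <= <v - w, w>] and [0 <= |v - w|^2]. *)
  move: (z - z') (P z - P z') => v w; rewrite !sqr_norm.
  by have := dot_ge0 (v - w); rewrite !dotE (dotC w v); lra.
pose c := 1 - alpha ^+ 2 / L ^+ 2.
(* If [alpha > L] then [c < 0] and the estimate forces [T] to be constant on [V];
   [Num.sqrt] vanishes on negative numbers, so the bound below covers that case. *)
pose T x := P (x - rho *: B x).
have T_contr x y : V x -> V y -> `|T x - T y| <= Num.sqrt c * `|x - y|.
  move=> Vx Vy.
  have : `|T x - T y| ^+ 2 <= c * `|x - y| ^+ 2.
    apply: (le_trans (P_nonexp _ _)).
    rewrite (_ : x - _ - (y - _) = (x - y) - rho *: (B x - B y)); last first.
      by rewrite scalerBr !opprD !opprK addrACA.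
    have := Bmono _ _ Vx Vy; have := Blip _ _ Vx Vy.
    move: (x - y) (B x - B y) => v w lip mono.
    have lip2 : `|w| ^+ 2 <= L ^+ 2 * `|v| ^+ 2.
      by rewrite -exprMn ler_pXn2r// nnegrE// mulr_ge0// ltW.
    have h1 : rho * (alpha * `|v| ^+ 2) <= rho * dot w v by rewrite ler_pM2l.
    have h2 : rho ^+ 2 * `|w| ^+ 2 <= rho ^+ 2 * (L ^+ 2 * `|v| ^+ 2).
      by rewrite ler_pM2l// exprn_gt0.
    have -> : `|v - rho *: w| ^+ 2 =
        `|v| ^+ 2 - 2 * (rho * dot w v) + rho ^+ 2 * `|w| ^+ 2.
      by rewrite !sqr_norm !dotE (dotC v w); ring.
    have -> : c * `|v| ^+ 2 = `|v| ^+ 2 - 2 * (rho * (alpha * `|v| ^+ 2)) +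
        rho ^+ 2 * (L ^+ 2 * `|v| ^+ 2).
      by rewrite /c /rho; field; rewrite gt_eqF.
    lra.
  move=> /ler_wsqrtr; rewrite [c * _]mulrC (sqrtrM c (sqr_ge0 _)).
  by rewrite !sqrtr_sqr !normr_id mulrC.
have TV : {homo T : x / V x >-> V x} by move=> x _; exact/gV/DP.
have [d Vd dT] : exists2 d, V d & d = T d.
  apply: (@banach_fixed_point _ _ V (mkfun_fun TV)) => //.
    exists (NngNum (sqrtr_ge0 c)); split.
      rewrite /= -[ltRHS]sqrtr1 ltr_sqrt// /c ltrBlDr ltrDl.
      by rewrite divr_gt0// exprn_gt0.
    by move=> [x y] /= [Vx Vy]; exact: T_contr.
  by exists (P 0); exact/gV/DP.
exists d; first by rewrite dT; exact: DP.
have := sP (d - rho *: B d); rewrite -/(T d) -dT.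
by rewrite addrAC subrr add0r scalerN scalerA mulVf ?scale1r// gt_eqF.
Qed.

(** * The conjugate function restricted to a closed subspace *)

Lemma conjugate_ge (f : X -> \bar K) x u :
  ((dot x u)%:E - f x <= conjugate dot f u)%E.
Proof. by apply: ereal_sup_ubound; exists x. Qed.

Lemma conjugate_minorant (f : X -> \bar K) : proper_function f ->
  exists a b, forall u, ((dot a u - b)%:E <= conjugate dot f u)%E.
Proof.
move=> [fNy [a]]; rewrite /effective_domain /=.
case fa: (f a) (fNy a) => [b| |]// _ _; exists a, b => u.
by have := conjugate_ge f a u; rewrite fa.
Qed.

(** A supremum of continuous affine functions is convex and lower semicontinuous;
    properness of [f] gives an affine minorant. *)
Lemma conjugate_Gamma0 (f : X -> \bar K) : proper_function f ->
  effective_domain (conjugate dot f) !=set0 -> Gamma0 (conjugate dot f).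
Proof.
move=> pf dom; have [fNy _] := pf; split.
- split=> // u; have [a [b ab]] := conjugate_minorant pf.
  exact: lt_le_trans (ltNyr _) (ab u).
- move=> u r /ereal_sup_gt[_ [x _ <-]] rx.
  exists [set v | (r%:E < (dot x v)%:E - f x)%E]; last first.
    by move=> v /= rv; exact: lt_le_trans rv (conjugate_ge f x v).
  case: (f x) (fNy x) rx => [s| |]//= _.
  rewrite -EFinB lte_fin ltrBrDr => rs.
  apply: filterS (cvgr_gt _ (@dot_continuous x u) _ rs) => v /=.
  by rewrite -EFinB lte_fin ltrBrDr.
- move=> u v t /andP[t0 t1]; apply: ge_ereal_sup => _ [x _ <-].
  have := conjugate_ge f x u; have := conjugate_ge f x v.
  case: (f x) (fNy x) => [s| |]//= _; last by move=> *; exact: leNye.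
  rewrite -!EFinB => hv hu.
  have -> : dot x (t *: u + (1 - t) *: v) - s =
      t * (dot x u - s) + (1 - t) * (dot x v - s) by rewrite !dotE; ring.
  rewrite EFinD !EFinM; apply: leeD; apply: lee_wpmul2l => //.
    by rewrite lee_fin ltW.
  by rewrite lee_fin subr_ge0 ltW.
Qed.

Lemma indicator_in (C : set X) x : C x -> indicator C x = 0%E :> \bar K.
Proof. by move=> Cx; rewrite /indicator mem_set. Qed.

Lemma indicator_out (C : set X) x : ~ C x -> indicator C x = +oo%E :> \bar K.
Proof. by move=> Cx; rewrite /indicator memNset. Qed.

Lemma Gamma0_add_indicator (g : X -> \bar K) (C : set X) :
  Gamma0 g -> closed C ->
  (forall x y (t : K), 0 < t < 1 -> C x -> C y -> C (t *: x + (1 - t) *: y)) ->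
  C `&` effective_domain g !=set0 ->
  Gamma0 (fun x => g x + indicator C x)%E.
Proof.
move=> [[gNy _] glsc gcvx] clC Ccvx [x0 [Cx0 Dx0]].
have ind_out x : ~ C x -> (g x + indicator C x = +oo)%E.
  by move=> Cx; rewrite indicator_out// addey// gt_eqF.
split.
- split; last by exists x0; rewrite /effective_domain /= indicator_in// adde0.
  move=> x; have [Cx|Cx] := pselect (C x).
    by rewrite indicator_in// adde0.
  by rewrite ind_out.
- move=> x a; have [Cx|Cx] := pselect (C x).
    rewrite indicator_in// adde0 => /glsc[V nV Va]; exists V => // y Vy.
    apply: (lt_le_trans (Va _ Vy)); rewrite leeDl// /indicator.
    by case: ifP => // _; rewrite leey.
  move=> _; exists (~` C).
    by apply: open_nbhs_nbhs; split=> //; exact: closed_openC.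
  by move=> y Cy; rewrite ind_out// ltry.
- move=> x y t t01; have /andP[t0 t1] := t01.
  have [Cx|Cx] := pselect (C x); last first.
    rewrite (ind_out x)// gt0_muley ?lte_fin// addye ?leey//.
    have [Cy|Cy] := pselect (C y); last by rewrite ind_out// gt0_muley// lte_fin subr_gt0.
    rewrite indicator_in// adde0; case: (g y) (gNy y) => [s| |]// _.
    by rewrite gt0_muley// lte_fin subr_gt0.
  have [Cy|Cy] := pselect (C y); last first.
    rewrite (ind_out y)// gt0_muley ?lte_fin ?subr_gt0// addey ?leey//.
    rewrite indicator_in// adde0; case: (g x) (gNy x) => [s| |]// _.
    by rewrite gt0_muley// lte_fin.
  by rewrite !indicator_in ?adde0//; [exact: gcvx|exact: Ccvx].
Qed.

Lemma orthocomplement_closed (A : set X) : closed (orthocomplement dot A).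
Proof.
rewrite (_ : orthocomplement dot A = \bigcap_(a in A) (dot a @^-1` [set 0])).
  apply: closed_bigI => a _; have /continuous_closedP := @dot_continuous a.
  by apply; exact: closed_eq.
by apply/seteqP; split=> x /= xA a Aa; have := xA a Aa; rewrite /= dotC.
Qed.

Lemma orthocomplement_combine (A : set X) (x y : X) (s t : K) :
  orthocomplement dot A x -> orthocomplement dot A y ->
  orthocomplement dot A (s *: x + t *: y).
Proof. by move=> xA yA a Aa; rewrite dotDl !dotZl xA// yA// !mulr0 addr0. Qed.

(** * Cyclic linear isometries *)

Section CyclicIsometry.
Context (m : nat) (m_gt0 : (0 < m)%N) (R : {linear X -> X})
  (R_isometry : forall x : X, `|R x| = `|x|)
  (R_cyclic : forall x : X, iter m R x = x).
Local Notation Y := (Yspace dot R).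
Local Notation S := (Sop R).
Local Notation Q := (Qop m R).

(** Polarization. *)
Lemma isometry_dot x y : dot (R x) (R y) = dot x y.
Proof.
have := sqr_norm (x + y); rewrite -R_isometry sqr_norm linearD.
have := sqr_norm x; rewrite -R_isometry sqr_norm.
have := sqr_norm y; rewrite -R_isometry sqr_norm.
rewrite !dotE (dotC y x) (dotC (R y)); lra.
Qed.

Lemma iter_linearB i x y : iter i R (x - y) = iter i R x - iter i R y.
Proof. by elim: i => //= i ->; rewrite linearB. Qed.

Lemma norm_iter i x : `|iter i R x| = `|x|.
Proof. by elim: i => //= i <-; rewrite R_isometry. Qed.

Lemma QopB x y : Q (x - y) = Q x - Q y.
Proof.
rewrite /Qop -scalerBr -sumrB; congr (_ *: _); apply: eq_bigr => i _.
by rewrite iter_linearB scalerBr.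
Qed.

Lemma Qop_bounded x : `|Q x| <= m%:R * `|x|.
Proof.
rewrite /Qop normrZ ger0_norm ?invr_ge0//.
rewrite ler_pdivrMl ?ltr0n//; apply: (le_trans (ler_norm_sum _ _ _)).
have -> : m%:R * (m%:R * `|x|) = \sum_(0 <= i < m) (m%:R * `|x|).
  by rewrite sumr_const_nat subn0 mulr_natl.
rewrite [leRHS](big_ltn m_gt0) -[leLHS]add0r; apply: lerD; first exact: mulr_ge0.
apply: ler_sum_nat => i /andP[_ im].
by rewrite normrZ norm_iter normr_nat ler_wpM2r// ler_nat ltnW.
Qed.

Lemma sum_orbit_fixed x : Fix R (\sum_(0 <= i < m) iter i R x).
Proof.
rewrite /Fix /= linear_sum /=; under eq_bigr do rewrite -iterS.
case: m m_gt0 R_cyclic => // n _ cyc.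
by rewrite big_nat_recr//= big_nat_recl//= -iterS cyc addrC.
Qed.

Lemma Yspace_iter i x : Y x -> Y (iter i R x).
Proof.
move=> Yx; elim: i => //= i IH a Fa.
by rewrite -[a in dot _ a]Fa isometry_dot IH.
Qed.

(** The sum lies in [Y] and in [Fix R], hence is orthogonal to itself. *)
Lemma Yspace_sum_orbit x : Y x -> \sum_(0 <= i < m) iter i R x = 0.
Proof.
move=> Yx; apply: dot_eq0; set a := (X in dot _ X).
have Fa : Fix R a by exact: sum_orbit_fixed.
have : Y (\sum_(0 <= i < m) iter i R x).
  elim/big_ind : _ => [b _|u v Yu Yv|i _]; [exact: dot0l| |exact: Yspace_iter].
  by rewrite -(scale1r u) -(scale1r v); exact: orthocomplement_combine.
exact.
Qed.

(** For a fixed vector [a], [<R x, a> = <R x, R a> = <x, a>]. *)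
Lemma Sop_Yspace x : Y (S x).
Proof. by move=> a Fa; rewrite dotDl dotNl -{1}Fa isometry_dot subrr. Qed.

Lemma Qop_Yspace x : Y x -> Y (Q x).
Proof.
move=> Yx.
have Ysum : Y (\sum_(1 <= i < m) i%:R *: iter i R x).
  elim/big_ind : _ => [b _|u v Yu Yv|i _]; first exact: dot0l.
    by rewrite -(scale1r u) -(scale1r v); exact: orthocomplement_combine.
  by move=> a Fa; rewrite dotZl Yspace_iter// mulr0.
by move=> a Fa; rewrite dotZl Ysum// mulr0.
Qed.

(** Abel summation of [i (R^(i+1) - R^i)]; the boundary term is [m R^m = m Id]. *)
Lemma Sop_Qop_average x : S (Q x) = x - m%:R^-1 *: \sum_(0 <= i < m) iter i R x.
Proof.
have tele n : \sum_(0 <= i < n) i%:R *: (iter i.+1 R x - iter i R x) =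
    n%:R *: iter n R x - \sum_(0 <= i < n) iter i.+1 R x.
  elim: n => [|n IH]; first by rewrite !big_nil scale0r subr0.
  rewrite !big_nat_recr//= IH scalerBr -[n.+1]addn1 natrD scalerDl scale1r.
  by rewrite opprD [RHS]addrACA subrr addr0 addrC addrA subrK.
have Q0 : Q x = m%:R^-1 *: \sum_(0 <= i < m) i%:R *: iter i R x.
  by rewrite [in RHS](big_ltn m_gt0) scale0r add0r.
rewrite /Sop Q0 linearZ linear_sum -scalerBr -sumrB.
under eq_bigr do rewrite linearZ -iterS -scalerBr.
rewrite tele R_cyclic scalerBr scalerA mulVf ?pnatr_eq0 ?lt0n_neq0// scale1r.
congr (_ - _ *: _); have := sum_orbit_fixed x; rewrite /Fix /= linear_sum => <-.
by apply: eq_bigr.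
Qed.

Lemma Sop_Qop x : Y x -> S (Q x) = x.
Proof. by move=> Yx; rewrite Sop_Qop_average Yspace_sum_orbit// scaler0 subr0. Qed.

(** Expand [|R x|^2 = |x + S x|^2] and use [|R x| = |x|]. *)
Lemma dot_Sop x : dot (S x) x = - (2^-1 * `|S x| ^+ 2).
Proof.
have := isometry_dot x x; rewrite sqr_norm /Sop !dotE (dotC x (R x)) => ->.
by field.
Qed.

(** [- Q] is half the identity plus a skew operator on [Y]; this is what makes the
    inclusion solvable. *)
Lemma dot_Qop y : Y y -> dot (Q y) y = - (2^-1 * `|y| ^+ 2).
Proof. by move=> Yy; rewrite -{2 3}(Sop_Qop Yy) dotC dot_Sop. Qed.

End CyclicIsometry.
End InnerProduct.

(** * Existence and uniqueness of the pair *)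

Theorem lemma3p1 (K : realType) (X : completeNormedModType K)
    (dot : {dot X for idfun})
    (norm_dot : forall x : X, `|x| = Num.sqrt (dot x x))
    (m : nat) (m_gt0 : (0 < m)%N)
    (R : {linear X -> X})
    (R_isometry : forall x : X, `|R x| = `|x|)
    (R_cyclic : forall x : X, iter m R x = x)
    (f : X -> \bar K) (f_Gamma0 : Gamma0 f) :
  let Y := Yspace dot R in
  let S := Sop R in
  let Q := Qop m R in
  let fs := conjugate dot f in
  let ineq_on_Y e :=
    forall y, Y y -> (fs (S e) + (dot (y - S e)%R e)%:E - fs y <= 0)%E in
  let solution (p : X * X) :=
    let: (e, d) := p in
    [/\ Y e /\ Y d, d = S e, effective_domain fs d, e = Q d & ineq_on_Y e] in
  Y `&` effective_domain fs !=set0 ->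
  [/\ exists! p : X * X, solution p,
      forall e, Y e -> effective_domain fs (S e) ->
        (ineq_on_Y e <->
         subdifferential dot (fun y => fs y + indicator Y y)%E (S e) e)
    & forall e d, solution (e, d) ->
        forall x, (fs (S e) + (dot (S x - S e)%R e)%:E - fs (S x) <= 0)%E].
Proof.
move=> Y S Q fs ineq_on_Y solution [y0 [Yy0 Dy0]].
have [f_proper _ _] := f_Gamma0.
have YS x : Y (S x) by exact: Sop_Yspace norm_dot _ R_isometry x.
have Gfs : Gamma0 fs by apply: conjugate_Gamma0 => //; exists y0.
have [[fsNy _] _ _] := Gfs.
pose g := (fun y => fs y + indicator Y y)%E.
have gY y : Y y -> g y = fs y by move=> Yy; rewrite /g indicator_in// adde0.
have gNY y : ~ Y y -> g y = +oo%E.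
  by move=> Yy; rewrite /g indicator_out// addey// gt_eqF// fsNy.
have ineq_subdiff e : effective_domain fs (S e) ->
    ineq_on_Y e <-> subdifferential dot g (S e) e.
  move=> De; have fsE := Gamma0_fine Gfs De.
  split=> [ineq y|sub y Yy].
    have [Yy|Yy] := pselect (Y y); last by rewrite (gNY y)// leey.
    have := ineq y Yy; rewrite !gY// fsE dotC.
    case: (fs y) (fsNy y) => [r| |]// _; last by rewrite leey.
    by rewrite -!EFinD !lee_fin subr_le0.
  have := sub y; rewrite !gY// fsE [dot e _]dotC.
  case: (fs y) (fsNy y) => [r| |]// _; last by move=> _; rewrite addeNy leNye.
  by rewrite -!EFinD !lee_fin subr_le0.
split=> [|e _ De|e d [_ _ _ _ ineq] x]; last exact: ineq; last exact: ineq_subdiff.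
have clY : closed Y by exact: orthocomplement_closed.
have Gg : Gamma0 g.
  apply: Gamma0_add_indicator => //; last by exists y0.
  by move=> x y t _; exact: orthocomplement_combine.
have domg : effective_domain g `<=` Y.
  by move=> y; rewrite /effective_domain /=; have [//|/gNY->] := pselect (Y y).
have [a [b minor]] := conjugate_minorant dot f_proper.
have g_minor y : ((dot a y - b)%:E <= g y)%E.
  have [Yy|Yy] := pselect (Y y); last by rewrite gNY// leey.
  by rewrite gY.
have SopQopK y : Y y -> S (Q y) = y by exact: Sop_Qop.
have dot_QopE y : Y y -> dot (Q y) y = - (2^-1 * `|y| ^+ 2) by exact: dot_Qop.
have [d Dd sub] : exists2 d, effective_domain g d & subdifferential dot g d (- - Q d).
  apply: (strongly_monotone_inclusion norm_dot (B := fun x => - Q x)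
    (alpha := 2^-1) (L := m%:R) Gg g_minor clY domg) => //.
  - by rewrite ltr0n.
  - move=> x y Yx Yy; rewrite -opprD -QopB dotNl.
    have Yxy : Y (x - y).
      by rewrite -[x]scale1r -scaleN1r; exact: orthocomplement_combine.
    by rewrite dot_QopE// opprK.
  - by move=> x y Yx Yy; rewrite -opprD normrN -QopB; exact: Qop_bounded.
rewrite opprK in sub.
have Yd := domg _ Dd; have SQd := SopQopK d Yd.
have Dfs : effective_domain fs d by rewrite /effective_domain /= -gY.
exists (Q d, d); split.
  split=> //; first by split=> //; exact: Qop_Yspace.
  by apply/ineq_subdiff; rewrite SQd.
move=> [e' d'] [[Ye' Yd'] d'E Dd' e'E /(ineq_subdiff _)].
rewrite -d'E => /(_ Dd') sub'.
have fin y : Y y -> effective_domain fs y -> g y \is a fin_num.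
  by move=> Yy Dy; rewrite gY// (Gamma0_fine Gfs Dy).
have := subdifferential_monotone (fin _ Yd Dfs) (fin _ Yd' Dd') sub sub'.
rewrite e'E -QopB.
have Ydd : Y (d - d').
  by rewrite -[d]scale1r -scaleN1r; exact: orthocomplement_combine.
rewrite dot_QopE// oppr_ge0 pmulr_rle0//.
move=> dd0; have /eqP : `|d - d'| ^+ 2 = 0 by apply/le_anti; rewrite dd0 sqr_ge0.
by rewrite sqrf_eq0 normr_eq0 subr_eq0 => /eqP->.
Qed.
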